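(* Let $k$ be an algebraically closed field of characteristic $p>0$, let $q=p^e$ with $e\ge1$, and let $X\subset\mathbb P^3_k$ be a smooth extremal surface of degree $q+1$ defined by a Hermitian form. Then the star points of $X$ are precisely its $\mathbb F_{q^2}$-points.
   Context: $k$ is an algebraically closed field of characteristic $p>0$ and $q=p^e$ with $e\ge1$. A Frobenius form is a homogeneous polynomial of degree $q+1$ that can be written $(\vec x^{[q]})^\top A\,\vec x$ for a (unique) square matrix $A$ over $k$, where $\vec x$ is the column vector of variables and $B^{[q]}$ denotes the matrix obtained by raising every entry of $B$ to the $q$-th power. An extremal surface of degree $q+1$ is a surface in $\mathbb P^3_k$ defined by a Frobenius form of degree $q+1$ in four variables. A Hermitian form is a Frobenius form whose matrix satisfies $(A^{[q]})^\top=A$ (so its entries lie in $\mathbb F_{q^2}$). A star on a smooth surface $X\subset\mathbb P^3$ of degree $d$ is a configuration of $d$ (distinct) lines on $X$ all meeting at one point $p$, and such a point $p$ is called a star point of $X$. *)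

(* Defs.v *)
From mathcomp Require Import all_boot all_order all_algebra.
From mathcomp Require Import mpoly.
Set Implicit Arguments.
Unset Strict Implicit.
Unset Printing Implicit Defensive.
Import GRing.Theory.
Local Open Scope ring_scope.

(* B^[q]: every entry of B raised to the q-th power. *)
Definition frob_mx (R : nzRingType) (m n q : nat) (B : 'M[R]_(m, n)) :
  'M[R]_(m, n) := map_mx (fun a => a ^+ q) B.

Definition var_col (R : nzRingType) (n : nat) : 'cV[{mpoly R[n]}]_n :=
  \col_(i < n) 'X_i.

(* (x^[q])^T A x as a polynomial; the product is a 1 x 1 matrix. *)
Definition frob_poly (R : comNzRingType) (n q : nat) (A : 'M[R]_n) :
  {mpoly R[n]} :=
  ((frob_mx q (var_col R n))^T *m map_mx (@mpolyC n R) A *m var_col R n) 0 0.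

Definition frobenius_form_of (R : comNzRingType) (n q : nat) (A : 'M[R]_n)
  (f : {mpoly R[n]}) : Prop :=
  f \is q.+1.-homog /\ f = frob_poly q A.

Definition hermitian_form (R : comNzRingType) (n q : nat) (f : {mpoly R[n]}) :
  Prop :=
  exists A : 'M[R]_n, frobenius_form_of q A f /\ (frob_mx q A)^T = A.

(* Linear subvarieties of P^(n-1) are represented by the linear subspaces of
   k^n: dimension 1 for points and dimension 2 for lines. *)
Definition proj_point (k : fieldType) (n : nat) (P : {vspace 'rV[k]_n}) : Prop :=
  \dim P = 1%N.

Definition proj_line (k : fieldType) (n : nat) (L : {vspace 'rV[k]_n}) : Prop :=
  \dim L = 2%N.

(* Set-theoretic containment of the linear subvariety W in f = 0. Over an
   infinite field this is the same as scheme-theoretic containment. *)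
Definition lies_on (k : fieldType) (n : nat) (f : {mpoly k[n]})
  (W : {vspace 'rV[k]_n}) : Prop :=
  forall v : 'rV[k]_n, v \in W -> f.@[fun i => v 0 i] = 0.

(* Smoothness of the hypersurface f = 0 over an algebraically closed field:
   at each of its points some partial derivative does not vanish. The zero
   polynomial does not satisfy this when 0 < n. *)
Definition smooth_hypersurface (k : fieldType) (n : nat) (f : {mpoly k[n]}) :
  Prop :=
  forall v : 'rV[k]_n, v != 0 -> f.@[fun i => v 0 i] = 0 ->
    exists i : 'I_n, (f^`M(i)).@[fun j => v 0 j] != 0.

Definition star (k : fieldType) (d : nat) (f : {mpoly k[4]})
  (P : {vspace 'rV[k]_4}) (s : seq {vspace 'rV[k]_4}) : Prop :=
  [/\ uniq s, size s = d
    & forall L, L \in s -> [/\ proj_line L, lies_on f L & (P <= L)%VS]].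

(* d is the degree of f. *)
Definition star_point (k : fieldType) (d : nat) (f : {mpoly k[4]})
  (P : {vspace 'rV[k]_4}) : Prop :=
  proj_point P /\ exists s : seq {vspace 'rV[k]_4}, star d f P s.

(* A point of f = 0 with homogeneous coordinates in the subfield F_Q of k;
   in an algebraically closed field of characteristic p, with Q a positive
   power of p, that subfield is the set of solutions of a ^+ Q = a. *)
Definition rational_point (k : fieldType) (n Q : nat) (f : {mpoly k[n]})
  (P : {vspace 'rV[k]_n}) : Prop :=
  [/\ proj_point P, lies_on f P
    & exists v : 'rV[k]_n,
        [/\ v \in P, v != 0 & forall i, v 0 i ^+ Q = v 0 i]].

(* Main.v *)
Require Import Defs.
From mathcomp Require Import all_boot all_order all_algebra.
From mathcomp Require Import separable mpoly ring.
Set Implicit Arguments.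
Unset Strict Implicit.
Unset Printing Implicit Defensive.
Import GRing.Theory.
Local Open Scope ring_scope.

(* Write f(x) = h(x, x) with h(x, y) = (x^[q])^T A y, additive in both
   arguments. Smoothness means that A is invertible, so that h(u, -) and
   h(v, -) are independent linear forms when u and v are. The Hermitian
   condition reads h(x, y)^q = h(y, sigma x), with sigma the q^2-Frobenius.

   A linear subspace on X is totally isotropic for h. If v = sigma u spans a
   star point, a line on X through v is therefore killed by both h(v, -) and
   h(u, -); were u and v independent, there would be only one such line. So
   sigma u is proportional to u, and a multiple of v is fixed by sigma.

   Conversely, let v be fixed by sigma. On the tangent hyperplane
   T = (h(v, -) = 0) the vector v lies in both radicals of h and spans them, so
   h induces a nondegenerate form on the plane T / <v>. Its q + 1 zeros are
   distinct, and each of them gives a line on X through v. *)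

(** * Roots in an algebraically closed field, and dimension counts *)

Lemma exists_root {k : closedFieldType} {m : nat} (a : k) :
  (0 < m)%N -> exists b : k, b ^+ m = a.
Proof.
case: m => // m _.
have [b Hb] := solve_monicpoly (fun i => if i is 0 then a else 0) (ltn0Sn m).
exists b; rewrite Hb big_ord_recl expr0 mulr1 big1 ?addr0 // => i _.
by rewrite mul0r.
Qed.

(** Lets kernel vectors and the coefficients of linear relations be taken as Frobenius powers. *)
Lemma exists_frob_mx_root {k : closedFieldType} {m n r : nat}
    (B : 'M[k]_(m, n)) :
  (0 < r)%N -> exists C : 'M[k]_(m, n), frob_mx r C = B.
Proof.
move=> r_gt0.
have /fin_all_exists [c Hc] (ij : 'I_m * 'I_n) :=
  exists_root (B ij.1 ij.2) r_gt0.
by exists (\matrix_(i, j) c (i, j)); apply/matrixP => i j; rewrite !mxE Hc.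
Qed.

Lemma dim_add_vline {K : fieldType} {vT : vectType K} {U : {vspace vT}} {x} :
  x \notin U -> \dim (U + <[x]>) = (\dim U).+1.
Proof.
move=> xU; rewrite dimv_disjoint_sum; last first.
  apply/eqP; rewrite -subv0; apply/subvP => y.
  rewrite memv_cap => /andP[yU /vlineP[c def_y]]; rewrite memv0 def_y.
  have [->|c_neq0] := eqVneq c 0; first by rewrite scale0r.
  by move: yU xU; rewrite def_y rpredZeq (negPf c_neq0) /= => ->.
rewrite dim_vline; suff -> : x != 0 by rewrite addn1.
by apply: contraNneq xU => ->; rewrite mem0v.
Qed.

Lemma dim_lker_mulmxr {K : fieldType} {m n : nat} (B : 'M[K]_(m, n)) :
  row_full B -> (\dim (lker (linfun (mulmxr B : 'rV_m -> 'rV_n))) + n = m)%N.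
Proof.
move=> Bfull; have := limg_ker_dim (linfun (mulmxr B : 'rV_m -> 'rV_n)) fullv.
rewrite capfv dimvf dim_matrix mul1r.
suff -> : limg (linfun (mulmxr B : 'rV_m -> 'rV_n)) = fullv.
  by rewrite dimvf dim_matrix mul1r.
apply/vspaceP => y; rewrite memvf; apply/memv_imgP.
have /submxP[x ->] := submx_full y Bfull.
by exists x; rewrite ?memvf // lfunE.
Qed.

(** * The pairing attached to a Frobenius form *)

Section FrobeniusPairing.

Variables (k : closedFieldType) (q : nat).
Hypotheses (q_nat : [pchar k].-nat q) (q_gt1 : (1 < q)%N).

Let q_gt0 : (0 < q)%N. Proof. exact: ltnW. Qed.

Lemma pchar_nat_natr_eq0 : q%:R = 0 :> k.
Proof.
apply/eqP/negPn/negP; rewrite natf_neq0_pchar => /(pnat_1 q_nat) q1.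
by move: q_gt1; rewrite q1.
Qed.

Lemma frob_mxM m n r (B : 'M[k]_(m, n)) (C : 'M_(n, r)) :
  frob_mx q (B *m C) = frob_mx q B *m frob_mx q C.
Proof.
apply/matrixP => i j; rewrite !mxE.
rewrite (big_morph (fun a : k => a ^+ q) (id1 := 0) (op1 := +%R)).
- by apply: eq_bigr => l _; rewrite !mxE exprMn.
- by move=> x y; rewrite exprDn_pchar.
- by rewrite expr0n eqn0Ngt q_gt0.
Qed.

Lemma frob_mxD m n (B C : 'M[k]_(m, n)) :
  frob_mx q (B + C) = frob_mx q B + frob_mx q C.
Proof. by apply/matrixP => i j; rewrite !mxE exprDn_pchar. Qed.

Lemma frob_mxZ r m n a (B : 'M[k]_(m, n)) :
  frob_mx r (a *: B) = a ^+ r *: frob_mx r B.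
Proof. by apply/matrixP => i j; rewrite !mxE exprMn. Qed.

Lemma frob_mx_eq0 r m n (B : 'M[k]_(m, n)) :
  (0 < r)%N -> (frob_mx r B == 0) = (B == 0).
Proof.
move=> r_gt0; apply/eqP/eqP => /matrixP B0; apply/matrixP => i j;
  move: (B0 i j); rewrite !mxE => /eqP.
  by rewrite expf_eq0 r_gt0 /= => /eqP.
by move/eqP->; rewrite expr0n eqn0Ngt r_gt0.
Qed.

Variables (n : nat) (A : 'M[k]_n).
Implicit Types (x y u v w : 'rV[k]_n) (U : {vspace 'rV[k]_n}).

Definition frob_pair u w : k := (frob_mx q u *m A *m w^T) 0 0.

Lemma frob_pairDl u v w : frob_pair (u + v) w = frob_pair u w + frob_pair v w.
Proof. by rewrite /frob_pair frob_mxD !mulmxDl mxE. Qed.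

Lemma frob_pairZl a u w : frob_pair (a *: u) w = a ^+ q * frob_pair u w.
Proof. by rewrite /frob_pair frob_mxZ -!scalemxAl mxE. Qed.

Lemma frob_pairDr u v w : frob_pair u (v + w) = frob_pair u v + frob_pair u w.
Proof. by rewrite /frob_pair linearD mulmxDr mxE. Qed.

Lemma frob_pairZr a u w : frob_pair u (a *: w) = a * frob_pair u w.
Proof. by rewrite /frob_pair linearZ /= -scalemxAr mxE. Qed.

Lemma frob_pairE u w :
  frob_pair u w = \sum_j (\sum_i u 0 i ^+ q * A i j) * w 0 j.
Proof.
rewrite /frob_pair mxE; apply: eq_bigr => j _; rewrite !mxE; congr (_ * _).
by apply: eq_bigr => i _; rewrite mxE.
Qed.

Let frob_polyE : frob_poly q A =
  \sum_j (\sum_i (A i j)%:MP * 'X_i ^+ q) * 'X_j :> {mpoly k[n]}.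
Proof.
rewrite /frob_poly mxE; apply: eq_bigr => j _; rewrite !mxE; congr (_ * _).
by apply: eq_bigr => i _; rewrite !mxE mulrC.
Qed.

Lemma meval_frob_poly v :
  (frob_poly q A).@[fun i => v 0 i] = frob_pair v v.
Proof.
rewrite frob_polyE frob_pairE raddf_sum; apply: eq_bigr => j _ /=.
rewrite mevalM mevalXU raddf_sum; congr (_ * _); apply: eq_bigr => i _ /=.
by rewrite mevalM mevalC rmorphXn /= mevalXU mulrC.
Qed.

(** As [q] vanishes in [k], each ['X_i ^+ q] has derivative zero, so only the linear factors
    contribute. *)
Lemma meval_mderiv_frob_poly j v :
  ((frob_poly q A)^`M(j)).@[fun i => v 0 i] = (frob_mx q v *m A) 0 j.
Proof.
have mderiv_coef l : (\sum_i (A i l)%:MP * 'X_i ^+ q : {mpoly k[n]})^`M(j) = 0.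
  rewrite raddf_sum big1 // => i _ /=.
  by rewrite mderiv_mulC mpolyXn mderivX mulmnE natrM pchar_nat_natr_eq0
             mulr0 scale0r mulr0.
have -> : (frob_poly q A)^`M(j) = \sum_i (A i j)%:MP * 'X_i ^+ q.
  have deriv_term l : ((\sum_i (A i l)%:MP * 'X_i ^+ q) * 'X_l)^`M(j) =
      (\sum_i (A i l)%:MP * 'X_i ^+ q) *+ (l == j) :> {mpoly k[n]}.
    rewrite mderivM mderiv_coef mul0r add0r mderivX mnm1E.
    have [->|] := eqVneq l j; last by rewrite scale0r mulr0.
    by rewrite scale1r -[X in (X - _)%MM]add0m addmK mpolyX0 mulr1.
  rewrite frob_polyE (raddf_sum (mderiv j)) (eq_bigr _ (fun l _ => deriv_term l)).
  by rewrite (bigD1 j) //= eqxx [X in _ + X = _]big1 ?addr0 // => l /negPf->.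
rewrite raddf_sum mxE; apply: eq_bigr => i _ /=.
by rewrite mevalM mevalC rmorphXn /= mevalXU mxE mulrC.
Qed.

(** A nonzero row killed by [A] can be written [frob_mx q v], and [v] is then a singular point. *)
Lemma smooth_frob_poly_unitmx :
  smooth_hypersurface (frob_poly q A) -> A \in unitmx.
Proof.
move=> smoothA; rewrite -row_free_unit; apply: inj_row_free => w wA.
have [v def_w] := exists_frob_mx_root w q_gt0; rewrite -{}def_w in wA *.
apply/eqP; rewrite frob_mx_eq0 //; apply/negPn/negP => v_neq0.
have [|i] := smoothA v v_neq0.
  by rewrite meval_frob_poly /frob_pair wA mul0mx mxE.
by rewrite meval_mderiv_frob_poly wA mxE eqxx.
Qed.

(* With x and y isotropic, h(x + s y, x + s y) = s h(x, y) + s^q h(y, x); this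
   cannot vanish both at s = 1 and at some t with t^q != t. *)
Lemma frob_pair_polar U x y :
    x \in U -> y \in U -> frob_pair x y != 0 ->
  exists2 z, z \in U & frob_pair z z != 0.
Proof.
move=> xU yU xy_neq0.
have [xx|] := eqVneq (frob_pair x x) 0; last by exists x.
have [yy|] := eqVneq (frob_pair y y) 0; last by exists y.
have sumU s : x + s *: y \in U by rewrite memvD ?memvZ.
have sumE s : frob_pair (x + s *: y) (x + s *: y) =
    s * frob_pair x y + s ^+ q * frob_pair y x.
  rewrite !(frob_pairDl, frob_pairDr, frob_pairZl, frob_pairZr) xx yy.
  by rewrite !mulr0 addr0 add0r.
have [t] : exists t : k, ~~ root ('X^q - 'X) t.
  apply/closed_nonrootP; rewrite -size_poly_eq0 size_polyDl size_polyXn //.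
  by rewrite size_polyN size_polyX.
rewrite /root !hornerE => tq.
have [E1|] := eqVneq (frob_pair (x + 1 *: y) (x + 1 *: y)) 0; last first.
  by exists (x + 1 *: y).
exists (x + t *: y) => //; move/eqP: E1.
rewrite !sumE expr1n !mul1r addrC addr_eq0 => /eqP ->.
by rewrite mulrN addrC -mulNr -mulrDl mulf_neq0 // addrC -opprB oppr_eq0.
Qed.

(** For invertible [A] and a point [v] of the hypersurface, this is the tangent hyperplane at [v]:
    the gradient there is [frob_mx q v *m A]. *)
Definition orthv v : {vspace 'rV[k]_n} :=
  lker (linfun (mulmxr (frob_mx q v *m A)^T : 'rV_n -> 'rV_1)).

Lemma memv_orthv v w : (w \in orthv v) = (frob_pair v w == 0).
Proof.
rewrite memv_ker lfunE /= /frob_pair -[w *m _]trmxK trmx_mul trmxK trmx_eq0.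
apply/eqP/eqP => [->|E]; first by rewrite mxE.
by apply/matrixP => i j; rewrite !ord1 E mxE.
Qed.

Hypothesis A_unit : A \in unitmx.

Lemma dim_orthv v : v != 0 -> ((\dim (orthv v)).+1 = n)%N.
Proof.
move=> v_neq0; rewrite -addn1 dim_lker_mulmxr // -/(row_full _).
rewrite /row_full mxrank_tr mxrankMfree ?row_free_unit //.
by rewrite rank_rV frob_mx_eq0 // v_neq0.
Qed.

(** Taking [q]-th roots of coefficients turns a relation between the Frobenius twists of [u] and [v]
    into one between [u] and [v]. Hence [C] has rank 2, and so has [C *m A]. *)
Lemma dim_orthv_cap u v :
  v != 0 -> u \notin <[v]>%VS -> (\dim (orthv u :&: orthv v)).+2 = n.
Proof.
move=> v_neq0 uv; set C := col_mx (frob_mx q u) (frob_mx q v).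
have Cfree : row_free C.
  apply: inj_row_free => c; rewrite -[c]hsubmxK mul_row_col.
  have [a Ha] := exists_frob_mx_root (lsubmx c) q_gt0.
  have [b Hb] := exists_frob_mx_root (rsubmx c) q_gt0.
  rewrite -Ha -Hb -!frob_mxM -frob_mxD => /eqP.
  rewrite frob_mx_eq0 // [a]mx11_scalar [b]mx11_scalar !mul_scalar_mx => E.
  have a0 : a 0 0 = 0.
    apply/eqP/negPn/negP => a_neq0; case/negP: uv; apply/vlineP.
    exists (- ((a 0 0)^-1 * b 0 0)); rewrite scaleNr -scalerA -scalerN.
    by move: E; rewrite addr_eq0 => /eqP <-; rewrite scalerA mulVf ?scale1r.
  move: E; rewrite a0 scale0r add0r scaler_eq0 (negPf v_neq0) orbF => /eqP ->.
  apply/eqP; rewrite -scalemx1 scale0r.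
  have -> : frob_mx q (0 : 'M[k]_1) = 0 by apply/eqP; rewrite frob_mx_eq0.
  by rewrite row_mx0.
have <- : lker (linfun (mulmxr (C *m A)^T : 'rV_n -> 'rV_(1 + 1))) =
          (orthv u :&: orthv v)%VS.
  apply/vspaceP => w; rewrite memv_cap !memv_ker !lfunE /=.
  by rewrite mul_col_mx tr_col_mx mul_mx_row row_mx_eq0.
rewrite -addn2 dim_lker_mulmxr // /row_full mxrank_tr mxrankMfree //.
by rewrite row_free_unit.
Qed.

(** * Hermitian pairings *)

Hypothesis A_herm : (frob_mx q A)^T = A.

(** Apply Frobenius to the 1 x 1 product and transpose: the outer vectors trade places and the
    Hermitian condition restores [A] in the middle. *)
Lemma frob_pair_herm x y :
  frob_pair x y ^+ q = frob_pair y (frob_mx (q ^ 2) x).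
Proof.
have -> : frob_mx (q ^ 2) x = frob_mx q (frob_mx q x).
  by apply/matrixP => i j; rewrite !mxE -exprM mulnn.
have -> : frob_pair x y ^+ q = (frob_mx q (frob_mx q x *m A *m y^T)) 0 0.
  by rewrite mxE.
set M := frob_mx q _; have -> : M 0 0 = M^T 0 0 by rewrite [RHS]mxE.
rewrite /frob_pair /M !frob_mxM !trmx_mul A_herm mulmxA.
by congr ((_ *m _ *m _) _ _); apply/matrixP => i j; rewrite !mxE.
Qed.

Lemma frob_pair_fixed v z :
  frob_mx (q ^ 2) v = v -> frob_pair z v = frob_pair v z ^+ q.
Proof. by move=> v_fix; rewrite frob_pair_herm v_fix. Qed.

(** For independent vectors the intersection of the two hyperplanes would have one dimension less
    than [orthv v]. *)
Lemma sub_orthv_vline v z :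
  v != 0 -> (orthv v <= orthv z)%VS -> z \in <[v]>%VS.
Proof.
move=> v_neq0 /capv_idPr Tz; apply/negPn/negP => /(dim_orthv_cap v_neq0).
rewrite Tz => dimT; case: (n_Sn (\dim (orthv v)).+1).
by rewrite dimT dim_orthv.
Qed.

(** By polarization the pairing vanishes on all pairs from [U]. The vector [u] may lie outside [U],
    but the Hermitian identity makes [frob_pair w v] the [q]-th power of [frob_pair u w]. *)
Lemma isotropic_sub_orthv U u v :
    {in U, forall x, frob_pair x x = 0} -> v \in U ->
  frob_mx (q ^ 2) u = v -> (U <= orthv u :&: orthv v)%VS.
Proof.
move=> Uiso vU uv; apply/subvP => w wU; rewrite memv_cap !memv_orthv.
have iso x y : x \in U -> y \in U -> frob_pair x y == 0.
  move=> xU yU; apply/negPn/negP => /(frob_pair_polar xU yU)[z zU].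
  by rewrite Uiso ?eqxx.
have := iso w v wU vU; rewrite -uv -frob_pair_herm expf_eq0 q_gt0 /= => ->.
by rewrite uv iso.
Qed.

Lemma exists_fixed_scale u v :
    v != 0 -> u \in <[v]>%VS -> frob_mx (q ^ 2) u = v ->
  exists2 c, c != 0 & frob_mx (q ^ 2) (c *: v) = c *: v.
Proof.
move=> v_neq0 /vlineP[b ->]; rewrite frob_mxZ => v_def.
have exp_gt0 : (0 < (q ^ 2).-1)%N.
  by rewrite -ltnS prednK ?expn_gt0 ?q_gt0 // (ltn_exp2l 0).
(* Here [v] is [b ^+ (q ^ 2)] times its own twist, so [c *: v] is fixed when
   [c ^+ (q ^ 2) = c * b ^+ (q ^ 2)]. *)
have [c c_def] := exists_root (b ^+ (q ^ 2)) exp_gt0.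
exists c.
  apply: contraNneq v_neq0 => c0; rewrite -v_def -c_def c0 expr0n.
  by rewrite eqn0Ngt exp_gt0 scale0r.
rewrite frob_mxZ -[in RHS]v_def scalerA -c_def -exprS prednK //.
by rewrite expn_gt0 q_gt0.
Qed.

(* Restricted to the affine line [b + t a], the form is a polynomial of degree
   q + 1 in t whose derivative is [frob_pair (b + t a) a]. *)
Lemma isotropic_roots a b :
    frob_pair a a != 0 ->
    (forall t, let z := b + t *: a in
       frob_pair z z = 0 -> frob_pair z a != 0) ->
  exists r : seq k, [/\ uniq r, size r = q.+1
    & forall t, t \in r -> frob_pair (b + t *: a) (b + t *: a) = 0].
Proof.
move=> aa_neq0 sep.
pose F : {poly k} := frob_pair a a *: 'X^(q.+1) +
  (frob_pair a b *: 'X^q + (frob_pair b a *: 'X + (frob_pair b b)%:P)).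
have F_eval t : F.[t] = frob_pair (b + t *: a) (b + t *: a).
  rewrite !(frob_pairDl, frob_pairDr, frob_pairZl, frob_pairZr).
  by rewrite !(hornerD, hornerZ, hornerXn, hornerX, hornerC) exprS; ring.
have dF_eval t : F^`().[t] = frob_pair (b + t *: a) a.
  rewrite !(derivD, derivZ, derivXn, derivX, derivC) /= mulrS.
  rewrite !(frob_pairDl, frob_pairZl).
  rewrite !(hornerD, hornerZ, hornerMn, hornerXn, hornerX, hornerC).
  have mulrnq (c : k) : c *+ q = 0.
    by rewrite -mulr_natr pchar_nat_natr_eq0 mulr0.
  by rewrite !mulrnq; ring.
(* The leading coefficient [frob_pair a a] is nonzero, so the degree is exactly [q.+1]. *)
have szF : size F = q.+2.
  rewrite size_polyDl size_scale ?size_polyXn // ltnS.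
  rewrite (leq_trans (size_polyD _ _)) // geq_max.
  rewrite (leq_trans (size_scale_leq _ _)) ?size_polyXn //=.
  rewrite (leq_trans (size_polyD _ _)) // geq_max.
  rewrite (leq_trans (size_scale_leq _ _)) ?size_polyX //=.
  by rewrite (leq_trans (size_polyC_leq1 _)).
have F_neq0 : F != 0 by rewrite -size_poly_eq0 szF.
have [r F_split] := closed_field_poly_normal F.
have Fr : F %= \prod_(z <- r) ('X - z%:P).
  by rewrite {1}F_split eqp_scale // lead_coef_eq0.
exists r; split.
(* By hypothesis [F] and its derivative share no root, so all roots are simple. *)
- rewrite -separable_prod_XsubC -(eqp_separable Fr) separable_poly.unlock.
  apply: Pdiv.ClosedField.root_coprimep => t /rootP.
  by rewrite F_eval dF_eval; apply: sep.
- by have := eqp_size Fr; rewrite szF size_prod_XsubC => -[].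
- move=> t rt; rewrite -F_eval; apply/rootP.
  by rewrite (eqp_root Fr) root_prod_XsubC.
Qed.

End FrobeniusPairing.

(** * Star points and rational points *)

Section ExtremalSurface.

Variables (k : closedFieldType) (q : nat) (A : 'M[k]_4).
Hypotheses (q_nat : [pchar k].-nat q) (q_gt1 : (1 < q)%N).
Hypotheses (A_unit : A \in unitmx) (A_herm : (frob_mx q A)^T = A).
Implicit Types (v : 'rV[k]_4) (P L : {vspace 'rV[k]_4}).

Local Notation f := (frob_poly q A).
Local Notation h := (frob_pair q A).

Lemma lies_on_frob_poly L :
  lies_on f L <-> {in L, forall x, h x x = 0}.
Proof. by split=> H x /H; rewrite meval_frob_poly. Qed.

Lemma star_point_rational P :
  star_point q.+1 f P -> rational_point (q ^ 2) f P.
Proof.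
(* Two lines of the star suffice for the argument. *)
case=> dimP [[|L1 [|L2 s]] [s_uniq s_size starP]].
- by [].
- by move: s_size q_gt1 => [<-].
have [dimL1 /lies_on_frob_poly fL1 PL1] := starP L1 (mem_head _ _).
have [|dimL2 /lies_on_frob_poly fL2 PL2] := starP L2.
  by rewrite inE mem_head orbT.
have L12 : L1 != L2 by move: s_uniq; rewrite /= inE negb_or -andbA => /and3P[].
split=> //; first by apply/lies_on_frob_poly => x /(subvP PL1)/fL1.
pose v := vpick P; have vP : v \in P by apply: memv_pick.
have v_neq0 : v != 0 by rewrite vpick0 -dimv_eq0 dimP.
have [|u uv] := exists_frob_mx_root (r := q ^ 2) v.
  by rewrite expn_gt0 ltnW.
(* Otherwise the two hyperplanes meet in dimension 4 - 2 = 2, and both lines would equal this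
   intersection. *)
have u_line : u \in <[v]>%VS.
  apply/negPn/negP => /(dim_orthv_cap q_nat q_gt1 A_unit v_neq0) [dim_cap].
  have sub L : {in L, forall x, h x x = 0} -> (P <= L)%VS -> proj_line L ->
      L = (orthv q A u :&: orthv q A v)%VS.
    move=> fL /subvP/(_ v vP) vL dimL; apply/eqP; rewrite eqEdim.
    by rewrite isotropic_sub_orthv //= dim_cap dimL.
  by case/eqP: L12; rewrite (sub L1) // (sub L2).
have [c c_neq0 c_fix] := exists_fixed_scale q_gt1 v_neq0 u_line uv.
exists (c *: v); split; first exact: memvZ.
  by rewrite scaler_eq0 negb_or c_neq0.
by move=> i; move/matrixP: c_fix => /(_ 0 i); rewrite !mxE.
Qed.

Lemma rational_point_star P :
  rational_point (q ^ 2) f P -> star_point q.+1 f P.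
Proof.
case=> dimP /lies_on_frob_poly fP [v [vP v_neq0 v_rat]]; split=> //.
have v_fix : frob_mx (q ^ 2) v = v by apply/rowP => i; rewrite mxE.
have -> : P = <[v]>%VS.
  apply/eqP; rewrite eq_sym eqEdim -memvE vP dim_vline v_neq0.
  by rewrite [\dim P]dimP.
have vv := fP v vP; pose T := orthv q A v.
have dimT : \dim T = 3 by have [] := dim_orthv q_gt1 A_unit v_neq0.
have vT : v \in T by rewrite memv_orthv vv.
have T_vz z : z \in T -> h v z = 0 by rewrite memv_orthv => /eqP.
have T_zv z : z \in T -> h z v = 0.
  move=> /T_vz vz; rewrite (frob_pair_fixed q_nat q_gt1) // vz expr0n.
  by rewrite eqn0Ngt ltnW.
(* Nondegeneracy modulo [v]: only multiples of [v] are orthogonal to all of [T]. *)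
have T_kernel z : z \in T -> z \notin <[v]>%VS ->
    exists2 w, w \in T & h z w != 0.
  move=> zT zv; have /subvPn[w wT] : ~~ (T <= orthv q A z)%VS.
    by apply: contra zv; apply: sub_orthv_vline.
  by rewrite memv_orthv; exists w.
have [x xT xv] : exists2 x, x \in T & x \notin <[v]>%VS.
  by apply/subvPn/negP => /dimvS; rewrite dimT dim_vline v_neq0.
have [y yT xy] := T_kernel x xT xv.
(* The anisotropic [a] serves as the point at infinity of the projective line of [T] modulo [v], so
   every isotropic point lies in the affine chart [b + t *: a]. *)
have [a aT aa] := frob_pair_polar q_nat q_gt1 xT yT xy.
have av : a \notin <[v]>%VS.
  apply: contra aa => /vlineP[c ->]; rewrite frob_pairZl frob_pairZr vv.
  by rewrite !mulr0.
have dim_va : \dim (<[v]> + <[a]>) = 2.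
  by rewrite dim_add_vline // dim_vline v_neq0.
have [b bT bva] : exists2 b, b \in T & b \notin (<[v]> + <[a]>)%VS.
  by apply/subvPn/negP => /dimvS; rewrite dimT dim_va.
pose z t := b + t *: a.
have zT t : z t \in T by rewrite memvD ?memvZ.
have zva t : z t \notin (<[v]> + <[a]>)%VS.
  by rewrite rpredDr // memvZ // (subvP (addvSr _ _)) ?memv_line.
have zv t : z t \notin <[v]>%VS.
  by apply: contra (zva t); apply: (subvP (addvSl _ _)).
have [|r [r_uniq r_size zr]] := isotropic_roots q_nat q_gt1 (b := b) aa.
  (* At a multiple root [z t] would be orthogonal to [v], [a] and itself, which span [T], against
     [T_kernel]. *)
  move=> t /= zz; apply/negP => za.
  have [w wT] := T_kernel _ (zT t) (zv t).
  have -> : h (z t) w = 0; last by rewrite eqxx.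
  apply/eqP; rewrite -memv_orthv; apply: subvP wT.
  have /eqP <- : ((<[v]> + <[a]> + <[z t]>)%VS == T).
    rewrite eqEdim dim_add_vline // dim_va dimT leqnn andbT.
    by rewrite !subv_add -!memvE vT aT zT.
  by rewrite !subv_add -!memvE !memv_orthv T_zv // eqxx za zz eqxx.
pose L t := (<[v]> + <[z t]>)%VS.
have fL t : t \in r -> lies_on f (L t).
  move=> /zr; rewrite -/(z t) /L.
  move: (z t) (T_vz _ (zT t)) (T_zv _ (zT t)) => w vw wv ww.
  apply/lies_on_frob_poly => x' /memv_addP[_ /vlineP[c ->] [_ /vlineP[d ->] ->]].
  rewrite !(frob_pairDl, frob_pairDr, frob_pairZl, frob_pairZr) //.
  by rewrite vv vw wv ww !mulr0 !addr0.
exists (map L r); split; last 1 first.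
- move=> _ /mapP[t rt ->]; split; [|exact: fL|exact: addvSl].
  by rewrite /proj_line dim_add_vline // dim_vline v_neq0.
(* If [L s = L t] with [s] and [t] distinct, this line contains [(s - t) *: a], so [a] would be
   isotropic. *)
- rewrite map_inj_in_uniq // => s t rs rt Lst; apply/eqP/negPn/negP => s_neq_t.
  case/negP: aa; apply/eqP; apply: ((lies_on_frob_poly (L s)).1 (fL s rs)).
  have : (s - t) *: a \in L s.
    have -> : (s - t) *: a = z s - z t.
      by rewrite /z opprD addrACA subrr add0r scalerBl.
    have zL t' : z t' \in L t' by apply: (subvP (addvSr _ _)); apply: memv_line.
    by apply: memvB; rewrite // Lst.
  by rewrite rpredZeq subr_eq0 (negPf s_neq_t).
- by rewrite size_map.
Qed.

End ExtremalSurface.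

Unset Implicit Arguments.

Theorem proposition3p4p1 (k : closedFieldType) (p e q : nat)
    (hp : p \in [pchar k]) (he : (0 < e)%N) (hq : q = (p ^ e)%N)
    (f : {mpoly k[4]}) (hf : hermitian_form q f)
    (hX : smooth_hypersurface f) :
  forall P : {vspace 'rV[k]_4},
    star_point q.+1 f P <-> rational_point (q ^ 2) f P.
Proof.
have p_prime := pcharf_prime hp.
have q_gt1 : (1 < q)%N by rewrite hq -(exp1n e) ltn_exp2r ?prime_gt1.
have q_nat : [pchar k].-nat q.
  by rewrite hq pnatX (pnatE _ p_prime) hp.
case: hf => A [[_ def_f] A_herm]; rewrite {}def_f in hX *.
have A_unit := smooth_frob_poly_unitmx q_nat q_gt1 hX.
move=> P; split.
- exact: star_point_rational.
- exact: rational_point_star.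
Qed.
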